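(* The word $$w_3=b^2a^3b\,a^3b^3aba^2\,baba^2ba^2b^2a^2b^2ab^2aba\,b^2aba^3bab^3\,ab^3a$$ of length $53$ is a $3$-collapsing word on the alphabet $\{a,b\}$.
   Context: A (semi)automaton is a triple $\mathcal A=(Q,\Sigma,\delta)$ with $Q$ a finite set of states, $\Sigma$ an alphabet and $\delta:Q\times\Sigma\to Q$ a total function. Words act on states from the right, letter by letter from left to right: $qw$ is the state reached from $q$ by reading $w$, and $Qw=\{qw: q\in Q\}$. The deficiency of $w\in\Sigma^+$ for $\mathcal A$ is $|Q|-|Qw|$. The word $w$ is $3$-compressing for $\mathcal A$ if its deficiency is at least $3$; $\mathcal A$ is $3$-compressible if some word is $3$-compressing for it. A word $w\in\Sigma^+$ is $3$-collapsing if it is $3$-compressing for every $3$-compressible automaton with input alphabet $\Sigma$. *)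

(* Defs.v *)
From mathcomp Require Import all_boot.

Set Implicit Arguments.
Unset Strict Implicit.
Unset Printing Implicit Defensive.

Record semiautomaton (Sigma : Type) := Semiautomaton {
  state : finType;
  delta : state -> Sigma -> state
}.

Section Collapsing.

Variable Sigma : Type.

Definition run (A : semiautomaton Sigma) (q : state A) (w : seq Sigma) :
    state A :=
  foldl (@delta Sigma A) q w.

Definition image_word (A : semiautomaton Sigma) (w : seq Sigma) :
    {set state A} :=
  [set run q w | q : state A].

Definition deficiency (A : semiautomaton Sigma) (w : seq Sigma) : nat :=
  #|state A| - #|image_word A w|.

Definition compressing (k : nat) (A : semiautomaton Sigma) (w : seq Sigma) :
    Prop :=
  w <> [::] /\ k <= deficiency A w.

Definition compressible (k : nat) (A : semiautomaton Sigma) : Prop :=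
  exists w : seq Sigma, compressing k A w.

Definition collapsing (k : nat) (w : seq Sigma) : Prop :=
  w <> [::] /\
  forall A : semiautomaton Sigma, compressible k A -> compressing k A w.

End Collapsing.

Inductive letter := a | b.

Definition w3 : seq letter :=
  nseq 2 b ++ nseq 3 a ++ [:: b] ++
  nseq 3 a ++ nseq 3 b ++ [:: a; b] ++ nseq 2 a ++
  [:: b; a; b] ++ nseq 2 a ++ [:: b] ++ nseq 2 a ++ nseq 2 b ++ nseq 2 a ++
  nseq 2 b ++ [:: a] ++ nseq 2 b ++ [:: a; b; a] ++
  nseq 2 b ++ [:: a; b] ++ nseq 3 a ++ [:: b; a] ++ nseq 3 b ++
  [:: a] ++ nseq 3 b ++ [:: a].

(* Main.v *)
Require Import Defs.
From HB Require Import structures.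
From mathcomp Require Import all_boot.

Set Implicit Arguments.
Unset Strict Implicit.
Unset Printing Implicit Defensive.

(** For a word w, call a state missing if it lies outside Qw; the deficiency of
    w is the number of missing states, and it can only grow when w is extended
    on either side.  So if [w3] has deficiency at most 2 for an automaton, then
    so has every factor of [w3], and it must be shown that then every word
    whatsoever has deficiency at most 2.

    The missing set of wc depends only on the missing set M of w and on the
    letter c: it consists of the states all of whose c-preimages lie in M
    ([missing_rcons]).  To compute it one needs to know the states without
    c-preimage, the classes of states identified by c, and the images under c
    of the at most two elements of M.  Both c and cc are factors of [w3], and a
    counting argument shows that a letter with these two deficiencies at most 2
    acts in one of five ways as far as identified and missing states are
    concerned ([fits_shape]).

    The images are discovered lazily.  The states met so far are named by
    natural numbers.  When an unknown image is needed, it is either one of the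
    named states or a new one, which is then given the next name: this is a
    finite case distinction ([consistent_learn]), although nothing bounds the
    number of states of the automaton.  On each branch some factors of [w3] are
    read in turn.  If a missing set reaches three elements, the branch is
    contradictory.  Otherwise, after the last factor, the missing sets reachable
    by arbitrary words are enumerated, still with lazy case distinctions; this
    closes up with sets of at most two elements, so that no word compresses the
    automaton by 3 ([closed_deficiency]).

    This search is a boolean function, [check], whose soundness is [checkP] and
    whose value on nine factors of [w3] is obtained by evaluation
    ([check_factors]).  Reading only [w3] would be sound as well, but it commits
    to the images of many irrelevant states before reaching a constraint.
    Shorter factors that force contradictions early keep the search at about
    nine thousand nodes. *)

(** * Letters, and the symbolic description of their action *)

Definition letter_to_bool (c : letter) : bool := if c is b then true else false.
Definition letter_of_bool (x : bool) : letter := if x then b else a.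
Lemma letter_to_boolK : cancel letter_to_bool letter_of_bool.
Proof. by case. Qed.

HB.instance Definition _ := Equality.copy letter (can_type letter_to_boolK).

Definition at_letter (X : Type) (p : X * X) (c : letter) : X :=
  if c is a then p.1 else p.2.

(** The action of one letter up to the images of the single states: [holes] are
    the states outside the image, [blocks] the classes with more than one
    element of the kernel. States are given by their names. *)
Record shape := Shape { blocks : seq (seq nat); holes : seq nat }.

Definition pair_of_shape (D : shape) := (blocks D, holes D).

Lemma pair_of_shapeK : cancel pair_of_shape (fun x => Shape x.1 x.2).
Proof. by case. Qed.

HB.instance Definition _ := Equality.copy shape (can_type pair_of_shapeK).

Definition block_of (D : shape) (m : nat) : seq nat :=
  head [:: m] [seq P <- blocks D | m \in P].

(** The kernel classes contained in the set [M], each represented by its first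
    element: exactly their images are missing after the letter without being
    holes. *)
Definition full (D : shape) (M : seq nat) : seq nat :=
  [seq m <- M | (head m (block_of D m) == m) && all (mem M) (block_of D m)].

(** A table lists the known images of names under one letter. *)
Definition target (T : seq (nat * nat)) (m : nat) : option nat :=
  ohead [seq x.2 | x <- T & x.1 == m].

(** [Collapse]: at least three states are missing; [Ask m]: the image of the
    state named [m] is needed. *)
Inductive outcome := Collapse | Ask of nat | Next of seq nat.

(** The number of missing states is known before their names are, so a collapse
    is detected without asking for any image; this is the main pruning. *)
Definition step (D : shape) (T : seq (nat * nat)) (M : seq nat) : outcome :=
  let R := full D M in
  if 2 < size (holes D) + size R then Collapse
  else if [seq m <- R | ~~ target T m] is m :: _ then Ask m
  else Next (sort leq (undup (holes D ++ pmap (target T) R))).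

(** The image of [m] is not a hole, and it is not the known image of a state
    outside the class of [m]; the last choice [n] stands for a new state. *)
Definition choices (D : shape) (T : seq (nat * nat)) (n m : nat) : seq nat :=
  [seq j <- iota 0 n | (j \notin holes D) &&
      all (fun x => (x.2 == j) ==> (x.1 \in block_of D m)) T] ++ [:: n].

Definition table := (seq (nat * nat) * seq (nat * nat))%type.

Definition learn (T : table) (c : letter) (m j : nat) : table :=
  if c is a then ((m, j) :: T.1, T.2) else (T.1, (m, j) :: T.2).

(** * The search *)

Inductive verdict := Escape | Query of letter & nat | Closed.

Section Search.
Variable D : shape * shape.

(** Closes the family [seen] of missing sets under both letters; [todo] holds the
    pairs of a set and a letter that still have to be followed. *)
Fixpoint explore (fuel : nat) (T : table) (seen : seq (seq nat))
    (todo : seq (seq nat * letter)) : verdict :=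
  if fuel is k.+1 then
    if todo is (M, c) :: todo' then
      match step (at_letter D c) (at_letter T c) M with
      | Collapse => Escape
      | Ask m => Query c m
      | Next M' =>
          if M' \in seen then explore k T seen todo'
          else explore k T (M' :: seen) (todo' ++ [:: (M', a); (M', b)])
      end
    else Closed
  else Escape.

(** An [Escape] means failure, since at this stage all factors of interest have
    already been read. *)
Fixpoint close (fuel n : nat) (T : table) : bool :=
  if fuel is k.+1 then
    match explore k T [:: [::]] [:: ([::], a); ([::], b)] with
    | Escape => false
    | Query c m =>
        all (fun j => close k (maxn n j.+1) (learn T c m j))
            (choices (at_letter D c) (at_letter T c) n m)
    | Closed => true
    end
  else false.

(** [M] is the missing set of the part of the current factor that has been read,
    [v] the rest of that factor, and [ws] the factors to be read afterwards. *)
Fixpoint search (fuel n : nat) (T : table) (M : seq nat) (v : seq letter)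
    (ws : seq (seq letter)) : bool :=
  if fuel is k.+1 then
    match v, ws with
    | c :: v', _ =>
        match step (at_letter D c) (at_letter T c) M with
        | Collapse => true
        | Ask m =>
            all (fun j => search k (maxn n j.+1) (learn T c m j) M v ws)
                (choices (at_letter D c) (at_letter T c) n m)
        | Next M' => search k n T M' v' ws
        end
    | [::], w :: ws' => search k n T [::] w ws'
    | [::], [::] => close k n T
    end
  else false.
End Search.

(** All ways to name [k] distinct states when the names below [n] are in use,
    each with the resulting number of names. *)
Fixpoint namings (k n : nat) : seq (nat * seq nat) :=
  if k is k'.+1 then
    flatten [seq [seq (x.1, j :: x.2)
                 | x <- namings k' (maxn n j.+1) & j \notin x.2]
            | j <- iota 0 n.+1]
  else [:: (n, [::])].

Definition rename (s : seq nat) (D : shape) : shape :=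
  Shape [seq [seq nth 0 s i | i <- P] | P <- blocks D]
        [seq nth 0 s i | i <- holes D].

(** The possible shapes of a letter, each with the number of states it mentions:
    a permutation; deficiency 1 with the hole identified with another state, or
    not; deficiency 2 with both holes identified with one further state, or
    with two different ones. *)
Definition shapes : seq (nat * shape) :=
  [:: (0, Shape [::] [::]);
      (2, Shape [:: [:: 0; 1]] [:: 0]);
      (3, Shape [:: [:: 1; 2]] [:: 0]);
      (3, Shape [:: [:: 0; 1; 2]] [:: 0; 1]);
      (4, Shape [:: [:: 0; 2]; [:: 1; 3]] [:: 0; 1])].

(** The states mentioned by the shape of the letter [a] get the first names; those
    of the letter [b] are then named in all possible ways. *)
Definition check (fuel : nat) (words : seq (seq letter)) : bool :=
  all (fun sa => all (fun sb =>
    all (fun x => search (sa.2, rename x.2 sb.2) fuel x.1 ([::], [::]) [::] [::] words)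
        (namings sb.1 sa.1)) shapes) shapes.

(** * Missing states *)

Section Automaton.
Variable A : semiautomaton letter.
Notation Q := (state A).
Implicit Types (q r : Q) (S : {set Q}) (c : letter) (w v : seq letter).

Definition missing w : {set Q} := ~: image_word A w.

Definition push c S : {set Q} :=
  [set r | [forall q, (delta q c == r) ==> (q \in S)]].

Lemma deficiency_missing w : deficiency A w = #|missing w|.
Proof. by rewrite /deficiency -(cardsC (image_word A w)) addKn. Qed.

Lemma missing_nil : missing [::] = set0.
Proof.
apply/setP=> r; rewrite !inE; apply/negbF/imsetP; by exists r.
Qed.

Lemma in_push c S r : reflect (forall q, delta q c = r -> q \in S) (r \in push c S).
Proof.
rewrite inE; apply: (iffP forallP) => h q; first by move/eqP; apply/implyP.
by apply/implyP=> /eqP; apply: h.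
Qed.

Lemma missing_rcons w c : missing (rcons w c) = push c (missing w).
Proof.
apply/setP=> r; rewrite in_setC; apply/idP/in_push => [nr q qr | h].
  rewrite in_setC; apply: contra nr => /imsetP[p _ qE].
  by apply/imsetP; exists p; rewrite // /run foldl_rcons -[foldl _ _ _]qE.
apply/negP=> /imsetP[p _ rE].
have /h : delta (run p w) c = r by rewrite rE /run foldl_rcons.
by rewrite in_setC imset_f.
Qed.

Lemma missing1 c : missing [:: c] = push c set0.
Proof. by rewrite -[[:: c]]/(rcons [::] c) missing_rcons missing_nil. Qed.

Lemma pushS c S S' : S \subset S' -> push c S \subset push c S'.
Proof.
move=> /subsetP sSS'; apply/subsetP=> r /in_push h; apply/in_push=> q /h; exact: sSS'.
Qed.

Lemma deficiency_factor u v w : deficiency A v <= deficiency A (u ++ v ++ w).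
Proof.
apply: leq_sub2l.
apply: leq_trans (subset_leq_card _) (leq_imset_card (fun q => run q w) _).
apply/subsetP=> _ /imsetP[q _ ->]; rewrite /run !foldl_cat.
by apply: imset_f; apply: imset_f.
Qed.

(** * Soundness of one symbolic step *)

Definition injective_below n (e : nat -> Q) :=
  forall i j, i < n -> j < n -> e i = e j -> i = j.

(** The first clause keeps all names in [D] below [n]; the clause on [push c set0]
    says that [holes D] are the states without preimage. *)
Definition fits c n (e : nat -> Q) (D : shape) :=
  [/\ all (gtn n) (holes D) /\ all (all (gtn n)) (blocks D),
      uniq (holes D), uniq (flatten (blocks D)),
      push c set0 =i [seq e i | i <- holes D]
    & forall p q, delta p c = delta q c <->
       p = q \/ exists2 P, P \in blocks D & p \in map e P /\ q \in map e P].

Definition represents n (e : nat -> Q) M S :=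
  [/\ uniq M, all (gtn n) M & S =i map e M].

Definition edges c n (e : nat -> Q) (T : seq (nat * nat)) :=
  forall x, x \in T -> [/\ x.1 < n, x.2 < n & delta (e x.1) c = e x.2].

Lemma mem_map_below n (e : nat -> Q) P m : injective_below n e -> all (gtn n) P ->
  m < n -> (e m \in map e P) = (m \in P).
Proof.
move=> ie /allP Pn mn; apply/mapP/idP => [[k kP /ie ->] // | mP]; last by exists m.
exact: Pn.
Qed.

Section Letter.
Variables (c : letter) (n : nat) (e : nat -> Q) (D : shape) (T : seq (nat * nat)).
Hypotheses (ie : injective_below n e) (fD : fits c n e D) (eT : edges c n e T).

Lemma block_ofP m : m \in block_of D m /\
  (block_of D m = [:: m] /\ (forall P, P \in blocks D -> m \notin P)
   \/ block_of D m \in blocks D).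
Proof.
rewrite /block_of; case E: [seq P <- blocks D | m \in P] => [|P s] /=.
  split; first exact: mem_head. left; split=> // P PD.
  by apply/negP=> mP; have : P \in [::] by rewrite -E mem_filter mP.
have : P \in P :: s by rewrite mem_head.
by rewrite -E mem_filter => /andP[-> ->]; split=> //; right.
Qed.

Lemma flatten_uniq_eq (ss : seq (seq nat)) P P' m : uniq (flatten ss) ->
  P \in ss -> P' \in ss -> m \in P -> m \in P' -> P = P'.
Proof.
elim: ss => //= R ss IH; rewrite cat_uniq => /and3P[_ /hasPn h u].
have hR X : X \in ss -> m \in X -> m \in R -> False.
  move=> Xss mX mR; have /h : m \in flatten ss by apply/flattenP; exists X.
  by rewrite /= mR.
rewrite !inE => /orP[/eqP->|Ps] /orP[/eqP->|P's] // mP mP'.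
- by case: (hR P').
- by case: (hR P).
- exact: IH.
Qed.

Lemma block_of_eq m k : k \in block_of D m -> block_of D k = block_of D m.
Proof.
case: fD => _ _ uB _ _ km.
case: (block_ofP m) (block_ofP k) => mm [[Em nm]|Bm] [kk [[Ek nk]|Bk]].
- by move: km; rewrite Em inE => /eqP->.
- by move: km; rewrite Em inE => /eqP->.
- by move: (nk _ Bm); rewrite km.
- exact: (flatten_uniq_eq uB Bk Bm kk km).
Qed.

Lemma block_of_below m : m < n -> all (gtn n) (block_of D m).
Proof.
case: fD => -[_ /allP bn] _ _ _ _ mn.
by case: (block_ofP m) => _ [[-> _]|/bn //]; rewrite /= mn.
Qed.

(** A state without a name is alone in its class, because all larger classes are
    listed in the shape. *)
Lemma fiberE m q : m < n -> delta q c = delta (e m) c <-> q \in map e (block_of D m).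
Proof.
move=> mn; have mP := mem_map_below ie (block_of_below mn) mn.
case: (fD) => -[_ /allP bn] _ uB _ K.
case: (block_ofP m) => mm [[Em nm]|Bm].
  rewrite Em inE; split=> [/K[->//|[P PD [_]]]|/eqP->//].
  by rewrite (mem_map_below ie (bn _ PD) mn) => mP'; have := nm _ PD; rewrite mP'.
split=> [/K[->|[P PD [qP]]]|qB].
- by rewrite mP.
- rewrite (mem_map_below ie (bn _ PD) mn) => mP'.
  by rewrite (flatten_uniq_eq uB Bm PD mm mP').
- by apply/K; right; exists (block_of D m); rewrite // mP.
Qed.

Lemma fiber_names m k : m < n -> k < n ->
  delta (e k) c = delta (e m) c -> k \in block_of D m.
Proof.
by move=> mn kn /(fiberE _ mn); rewrite (mem_map_below ie (block_of_below mn) kn).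
Qed.

Lemma targetP m j : target T m = Some j -> [/\ m < n, j < n & delta (e m) c = e j].
Proof.
rewrite /target; case E: [seq x <- T | x.1 == m] => [|x s] //= [<-].
have : x \in x :: s by rewrite mem_head.
by rewrite -E mem_filter => /andP[/eqP <- /eT].
Qed.

Lemma full_head M m k : m \in full D M -> k \in full D M -> k \in block_of D m -> k = m.
Proof.
rewrite !mem_filter => /andP[/andP[/eqP hm _] _] /andP[/andP[/eqP hk _] _] km.
move: hm hk; rewrite (block_of_eq km).
by case: (block_of D m) km => //= x s _ <- <-.
Qed.

Variables (M : seq nat) (S : {set Q}).
Hypothesis nM : represents n e M S.

(** The missing states after the letter are the holes and the images of the
    classes inside the missing set; distinct classes have distinct images, none
    of which is a hole. *)
Lemma stepP :
  match step D T M return Prop with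
  | Collapse => 2 < #|push c S|
  | Ask m => m < n
  | Next M' => represents n e M' (push c S) /\ size M' <= 2
  end.
Proof.
case: (nM) => uM /allP Mn SM; case: (fD) => -[/allP hn _] uh _ hE _.
have fullM m : m \in full D M -> m \in M by rewrite mem_filter => /andP[].
have full_push m : m \in full D M -> delta (e m) c \in push c S.
  move=> mF; apply/in_push=> q /(fiberE _ (Mn _ (fullM _ mF))) /mapP[k km ->].
  rewrite SM map_f //; move: mF; rewrite mem_filter => /andP[/andP[_ /allP]] h _.
  exact: h.
have hole_push i : i \in holes D -> e i \in push c S.
  move=> ih; apply: (subsetP (pushS c (sub0set S))); by rewrite hE map_f.
rewrite /step; case: ltnP => [big | small].
  apply: leq_trans big _.
  have -> : size (holes D) + size (full D M) =
    size (map e (holes D) ++ map (fun m => delta (e m) c) (full D M)).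
    by rewrite size_cat !size_map.
  rewrite cardE; apply: uniq_leq_size.
    rewrite cat_uniq map_inj_in_uniq ?uh /=; last by move=> i j /hn ? /hn ?; apply: ie.
    rewrite map_inj_in_uniq ?filter_uniq ?andbT //.
      apply/hasPn=> _ /mapP[m mF ->]; apply/negP=> /=.
      rewrite -hE => /in_push /(_ _ erefl).
      by rewrite inE.
    move=> i j iF jF ij; apply: (full_head jF iF).
    by apply: fiber_names => //; apply: Mn; apply: fullM.
  move=> r; rewrite mem_cat mem_enum => /orP[] /mapP[i ? ->]; first exact: hole_push.
  exact: full_push.
case E: [seq m <- full D M | ~~ target T m] => [|m s]; last first.
  apply: Mn; apply: fullM; have : m \in m :: s by rewrite mem_head.
  by rewrite -E mem_filter => /andP[].
have tF m : m \in full D M -> exists j, target T m = Some j.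
  move=> mF; case F: (target T m) => [j|]; first by exists j.
  by have : m \in [::] by rewrite -E mem_filter F.
split; last first.
  rewrite size_sort (leq_trans (size_undup _)) // size_cat (leq_trans _ small) //.
  by rewrite leq_add2l size_pmap count_size.
split.
- by rewrite sort_uniq undup_uniq.
- apply/allP=> j; rewrite mem_sort mem_undup mem_cat => /orP[/hn//|].
  by rewrite mem_pmap => /mapP[m _ /esym /targetP[]].
move=> r; apply/idP/mapP => [rP | [j]].
  have [q /eqP qr | noq] := pickP (fun q => delta q c == r); last first.
    have : r \in push c set0 by apply/in_push=> q /eqP; rewrite noq.
    by rewrite hE => /mapP[j jh ->]; exists j; rewrite // mem_sort mem_undup mem_cat jh.
  have /in_push/(_ _ qr) := rP; rewrite SM => /mapP[m mM qm].
  have mn := Mn _ mM.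
  have blockM k : k \in block_of D m -> k \in M.
    move=> km; have kn : k < n by move/allP: (block_of_below mn); apply.
    have : delta (e k) c = r by rewrite -qr qm; apply/(fiberE _ mn); rewrite map_f.
    by move/(in_push _ _ _ rP); rewrite SM (mem_map_below ie) //; apply/allP.
  pose h := head m (block_of D m).
  have hm : h \in block_of D m.
    rewrite /h; case: (block_of D m) (block_ofP m) => [|x s] [] //= _ _.
    by rewrite mem_head.
  have hF : h \in full D M.
    rewrite mem_filter (block_of_eq hm) blockM // andbT.
    apply/andP; split; last exact/allP.
    by rewrite /h; case: (block_of D m) hm.
  have [j tj] := tF _ hF; exists j.
    by rewrite mem_sort mem_undup mem_cat mem_pmap -tj map_f ?orbT.
  have [_ _ <-] := targetP tj; rewrite -qr qm; apply/esym/fiberE => //.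
  exact: map_f.
rewrite mem_sort mem_undup mem_cat => /orP[jh ->|]; first exact: hole_push.
rewrite mem_pmap => /mapP[m mF /esym /targetP[_ _ <-]] ->; exact: full_push.
Qed.

End Letter.

(** * Naming new states *)
Definition agree n (e e' : nat -> Q) := forall i, i < n -> e' i = e i.

Lemma map_agree n (e e' : nat -> Q) P : agree n e e' -> all (gtn n) P ->
  map e' P = map e P.
Proof. by move=> ee /allP Pn; apply/eq_in_map => i /Pn; apply: ee. Qed.

Lemma all_gtnW n n' P : n <= n' -> all (gtn n) P -> all (gtn n') P.
Proof. by move=> nn; apply: sub_all => i /= i_n; apply: leq_trans nn. Qed.

Lemma extend_naming n (e : nat -> Q) q : injective_below n e ->
  exists j e', [/\ j <= n, agree n e e', injective_below (maxn n j.+1) e' & e' j = q].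
Proof.
move=> ie; have [/mapP[j] | qN] := boolP (q \in map e (iota 0 n)).
  rewrite mem_iota => jn ->; exists j, e.
  by split=> //; [exact: ltnW | rewrite (maxn_idPl jn)].
have qe i : i < n -> e i <> q.
  by move=> i_n iq; case/mapP: qN; exists i; rewrite ?mem_iota.
exists n, (fun i => if i == n then q else e i); split=> //.
- by move=> i i_n; rewrite ltn_eqF.
- rewrite (maxn_idPr (leqnSn n)) => i j; rewrite !ltnS => i_n j_n.
  have lt k : k <= n -> k != n -> k < n by rewrite ltn_neqAle => -> ->.
  case: (eqVneq i n) => [->|/(lt _ i_n) {}i_n];
    case: (eqVneq j n) => [->|/(lt _ j_n) {}j_n] //.
  + by move/esym/(qe _ j_n).
  + by move/(qe _ i_n).
  + exact: ie.
- by rewrite eqxx.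
Qed.

Lemma fits_agree c n n' (e e' : nat -> Q) D :
  n <= n' -> agree n e e' -> fits c n e D -> fits c n' e' D.
Proof.
move=> nn ee [[hn bn] uh ub hE K]; split=> //.
- split; first exact: all_gtnW hn.
  by apply: sub_all bn => P; apply: all_gtnW.
- by move=> r; rewrite (map_agree ee hn).
- move=> p q; split=> [/K|] [|[P PD]].
  + by left.
  + by rewrite -(map_agree ee (allP bn _ PD)) => ?; right; exists P.
  + by move=> ->.
  + by rewrite (map_agree ee (allP bn _ PD)) => ?; apply/K; right; exists P.
Qed.

Lemma edges_agree c n n' (e e' : nat -> Q) T :
  n <= n' -> agree n e e' -> edges c n e T -> edges c n' e' T.
Proof.
move=> nn ee eT x /eT[x1 x2 xE]; split; try exact: leq_trans nn.
by rewrite !ee.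
Qed.

Lemma represents_agree n n' (e e' : nat -> Q) M S :
  n <= n' -> agree n e e' -> represents n e M S -> represents n' e' M S.
Proof.
move=> nn ee [uM Mn SM]; split=> //; first exact: all_gtnW Mn.
by move=> r; rewrite SM (map_agree ee Mn).
Qed.

(** * Soundness of the search *)

Section Soundness.
Variable D : shape * shape.

Definition consistent n (e : nat -> Q) (T : table) :=
  injective_below n e /\
  forall c, fits c n e (at_letter D c) /\ edges c n e (at_letter T c).

(** The case distinction of the search is exhaustive: the actual image of [m] is
    among the choices, after extending the naming if it has no name yet. *)
Lemma consistent_learn n e T c m : consistent n e T -> m < n ->
  exists j e', [/\ j \in choices (at_letter D c) (at_letter T c) n m,
    n <= maxn n j.+1, agree n e e' & consistent (maxn n j.+1) e' (learn T c m j)].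
Proof.
move=> [ie h] mn; have [j [e' [jn ee ie' ej]]] := extend_naming (delta (e m) c) ie.
have nn : n <= maxn n j.+1 by exact: leq_maxl.
exists j, e'; split=> //.
  rewrite mem_cat mem_seq1.
  move: jn; rewrite leq_eqVlt => /orP[->|jn]; first by rewrite orbT.
  rewrite mem_filter mem_iota leq0n add0n jn !andbT; apply/orP; left.
  have [fD eT] := h c; move: ej; rewrite ee // => ej.
  apply/andP; split.
    apply/negP=> jh; have [_ _ _ hE _] := fD.
    have ejP : e j \in push c set0 by rewrite hE map_f.
    by have := in_push c _ _ ejP _ (esym ej); rewrite inE.
  apply/allP=> x /eT[x1 x2 xE]; apply/implyP=> /eqP xj.
  by apply: (fiber_names ie fD) => //; rewrite xE xj.
split=> // c'; have [fD eT] := h c'; split; first exact: fits_agree fD.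
have eT' := edges_agree nn ee eT.
suff new : c' = c -> [/\ m < maxn n j.+1, j < maxn n j.+1 & delta (e' m) c' = e' j].
  case: c c' eT' new {ej fD eT} => [] [] /= eT' new //;
  by move=> x; rewrite inE => /orP[/eqP->|/eT'//]; apply: new.
move=> ->; split; [exact: leq_trans nn | exact: leq_maxr | by rewrite ee // ej].
Qed.

Definition denote (e : nat -> Q) M : {set Q} := [set q in map e M].

Lemma represents_denote n e M S : represents n e M S -> S = denote e M.
Proof. by case=> _ _ SM; apply/setP=> r; rewrite inE SM. Qed.

(** The invariant of [explore]: every set in [seen] has each of its successors in
    [seen] too, unless the corresponding pair is pending. *)
Definition explored n (e : nat -> Q) (seen : seq (seq nat))
    (todo : seq (seq nat * letter)) :=
  [/\ forall M, M \in seen -> represents n e M (denote e M) /\ size M <= 2,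
      forall x, x \in todo -> x.1 \in seen
    & forall M c, M \in seen -> (M, c) \in todo \/
        exists2 M', M' \in seen & push c (denote e M) = denote e M'].

Lemma exploreP fuel n e T seen todo : consistent n e T -> explored n e seen todo ->
  match explore D fuel T seen todo with
  | Escape => True
  | Query _ m => m < n
  | Closed => exists2 seen', {subset seen <= seen'} & explored n e seen' [::]
  end.
Proof.
move=> vT; elim: fuel seen todo => //= k IH seen [|[M c] todo] //.
  by exists seen.
move=> [seenP todoP doneP].
have Mseen : M \in seen by apply: (todoP (M, c)); rewrite mem_head.
have [ie /(_ c) [fD eT]] := vT.
have := stepP ie fD eT (seenP _ Mseen).1.
case: step => //= M' [nM' sM']; have M'E := represents_denote nM'.
have todoP' x : x \in todo -> x.1 \in seen.
  by move=> xt; apply: todoP; rewrite inE xt orbT.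
case: ifP => M'seen.
  apply: IH; split=> // N d Nseen; case: (doneP N d Nseen); last by right.
  by rewrite inE => /orP[/eqP[-> ->]|]; [right; exists M' | left].
have es : explored n e (M' :: seen) (todo ++ [:: (M', a); (M', b)]).
  split=> [N|x|N d].
  - by rewrite inE => /orP[/eqP->|/seenP//]; rewrite -M'E.
  - rewrite mem_cat => /orP[/todoP' xs|]; first by rewrite inE xs orbT.
    by rewrite !inE => /orP[]/eqP->; rewrite /= eqxx.
  rewrite inE => /orP[/eqP->|Ns].
    by left; rewrite mem_cat !inE; case: d; rewrite eqxx ?orbT.
  case: (doneP N d Ns) => [|[N' N's ->]]; last first.
    by right; exists N'; rewrite // inE N's orbT.
  rewrite inE => /orP[/eqP[-> ->]|Nt]; last by left; rewrite mem_cat Nt.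
  by right; exists M'; rewrite // mem_head.
have := IH _ _ es; case: explore => // -[s sub ?].
by exists s => // N Ns; apply: sub; rewrite inE Ns orbT.
Qed.

(** A family of small missing sets that contains the empty one and is closed under
    both letters contains the missing set of every word. *)
Lemma closed_deficiency n e seen : [::] \in seen -> explored n e seen [::] ->
  forall w, deficiency A w <= 2.
Proof.
move=> s0 [seenP _ doneP] w.
suff [M Ms mE] : exists2 M, M \in seen & missing w = denote e M.
  have [_ sM] := seenP _ Ms; rewrite deficiency_missing mE /denote cardsE.
  by apply: leq_trans (card_size _) _; rewrite size_map.
elim/last_ind: w => [|w c [M Ms mE]].
  by exists [::] => //; rewrite missing_nil; apply/setP=> r; rewrite !inE.
by have [//|[M' M's E]] := doneP M c Ms; exists M'; rewrite // missing_rcons mE.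
Qed.

Lemma closeP fuel n e T : consistent n e T -> close D fuel n T ->
  forall w, deficiency A w <= 2.
Proof.
elim: fuel n e T => //= k IH n e T vT.
have e0 : explored n e [:: [::]] [:: ([::], a); ([::], b)].
  split=> [M|x|M c]; rewrite !inE.
  - by move/eqP->; split=> //; split=> // r; rewrite inE.
  - by case/orP=> /eqP->.
  - by move/eqP->; left; case: c; rewrite eqxx ?orbT.
have := exploreP k vT e0; case: explore => // [c m mn|[s sub es] _].
  have [j [e' [jc _ _ vT']]] := consistent_learn c vT mn.
  by move/allP/(_ _ jc); apply: IH vT'.
by apply: closed_deficiency es; apply: sub.
Qed.

(** The part [u] of the current factor already read together with the rest [v] is
    a word of deficiency at most 2; this refutes the branches that collapse. *)
Lemma searchP fuel n e T M u v ws : consistent n e T -> represents n e M (missing u) ->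
  deficiency A (u ++ v) <= 2 -> {in ws, forall w, deficiency A w <= 2} ->
  search D fuel n T M v ws -> forall w, deficiency A w <= 2.
Proof.
elim: fuel n e T M u v ws => //= k IH n e T M u [|c v] ws vT nM duv dws.
  case: ws dws => [|w ws] dws; first exact: closeP vT.
  apply: (IH _ e _ _ [::]) => //; first by split=> // r; rewrite missing_nil inE.
    by apply: dws; rewrite mem_head.
  by move=> x xs; apply: dws; rewrite inE xs orbT.
have [ie /(_ c) [fD eT]] := vT.
have := stepP ie fD eT nM; rewrite -missing_rcons; rewrite -cat_rcons in duv.
case: step => [big _|m mn|M' [nM' _]].
- have := leq_trans (deficiency_factor [::] (rcons u c) v) duv.
  by rewrite deficiency_missing leqNgt big.
- have [j [e' [jc nn ee vT']]] := consistent_learn c vT mn.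
  move/allP/(_ _ jc); apply: (IH _ e' _ _ u) => //; first exact: represents_agree nM.
  by rewrite -cat_rcons.
- exact: (IH _ e _ _ (rcons u c)).
Qed.

End Soundness.

Lemma namingsP k n (e y : nat -> Q) : injective_below n e -> injective_below k y ->
  exists x e', [/\ x \in namings k n, n <= x.1, agree n e e', injective_below x.1 e'
    & [/\ size x.2 = k, all (gtn x.1) x.2 & forall i, i < k -> e' (nth 0 x.2 i) = y i]].
Proof.
elim: k n e y => [|k IH] n e y ie iy.
  by exists (n, [::]), e; split=> //; rewrite mem_head.
have [j [e1 [jn ee1 ie1 ej]]] := extend_naming (y 0) ie.
have iy' : injective_below k (y \o S) by move=> i l ik lk /(iy i.+1 l.+1 ik lk) [].
have [[n' s] [e' [xin nn ee' ie' [ss sn sy]]]] := IH _ _ _ ie1 iy'.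
rewrite /= in xin nn ie' ss sn sy.
have nn' := leq_trans (leq_maxl n j.+1) nn.
have jn' : j < n' := leq_trans (leq_maxr n j.+1) nn.
have e'j : e' j = y 0 by rewrite ee' ?leq_maxr.
exists (n', j :: s), e'; split.
- apply/flattenP.
  exists [seq (x.1, j :: x.2) | x <- namings k (maxn n j.+1) & j \notin x.2].
    by apply/mapP; exists j; rewrite // mem_iota.
  apply/mapP; exists (n', s) => //; rewrite mem_filter xin andbT /=.
  apply/negP=> js; have ik : index j s < k by rewrite -ss index_mem.
  have := sy _ ik; rewrite nth_index //= e'j => /iy; rewrite ltnS => /(_ isT ik).
  by [].
- exact: leq_trans (leq_maxl n j.+1) nn.
- by move=> i i_n; rewrite ee' ?ee1 // leq_max i_n.
- exact: ie'.
- split=> [|| [|i] ik] //=; first by rewrite ss.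
  + by rewrite jn'.
  + exact: sy.
Qed.

Lemma map_rename k (e y : nat -> Q) s P : all (gtn k) P ->
  (forall i, i < k -> e (nth 0 s i) = y i) ->
  map e [seq nth 0 s i | i <- P] = map y P.
Proof. by move=> /allP Pk ey; rewrite -map_comp; apply/eq_in_map=> i /Pk /ey. Qed.

Lemma fits_rename c k n (e y : nat -> Q) s D : injective_below k y ->
  size s = k -> all (gtn n) s ->
  (forall i, i < k -> e (nth 0 s i) = y i) ->
  fits c k y D -> fits c n e (rename s D).
Proof.
move=> iy ss /all_nthP sn ey [[hk bk] uh ub hE K].
have below P : all (gtn k) P -> all (gtn n) [seq nth 0 s i | i <- P].
  by move/allP=> Pk; apply/allP=> _ /mapP[i /Pk ik ->]; apply: sn; rewrite ss.
have inj : {in gtn k &, injective (nth 0 s)}.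
  by move=> i j ik jk ij; apply: iy => //; rewrite -!ey // ij.
split=> /=.
- split; first exact: below.
  by apply/allP=> _ /mapP[P /(allP bk) Pk ->]; apply: below.
- by rewrite map_inj_in_uniq // => i j /(allP hk) ? /(allP hk) ?; apply: inj.
- rewrite -map_flatten map_inj_in_uniq // => i j.
  move=> /flattenP[P /(allP bk)/allP Pk /Pk ik].
  by move=> /flattenP[P' /(allP bk)/allP P'k /P'k jk]; apply: inj.
- by move=> r; rewrite (map_rename hk ey).
- move=> p q; split=> [/K|] [|[P PD]].
  + by left.
  + move=> h; right; exists [seq nth 0 s i | i <- P]; first exact: map_f.
    by rewrite (map_rename (allP bk _ PD) ey).
  + by move=> ->.
  + case/mapP: PD => P' P'D ->; rewrite (map_rename (allP bk _ P'D) ey) => h.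
    by apply/K; right; exists P'.
Qed.

(** * The shape of a letter *)

Section LetterShape.
Variables (q0 : Q) (c : letter).
Let f (q : Q) := delta q c.
Let Z := push c set0.

Lemma card_holes : #|Z| = #|Q| - #|f @: Q|.
Proof.
rewrite -(cardsC (f @: Q)) addKn; apply: eq_card => r; rewrite in_setC.
apply/in_push/idP => [h | rN q fq].
  by apply/imsetP=> -[q _ rE]; have := h q (esym rE); rewrite inE.
by case/imsetP: rN; exists q.
Qed.

(** A set that meets every class and misses as many states as the image does has
    as many elements as the image, so it meets every class once. *)
Lemma transversal_inj (R : {set Q}) : #|Z| <= #|~: R| ->
  (forall q, exists2 t, t \in R & f t = f q) -> {in R &, injective f}.
Proof.
move=> cR h; apply/imset_injP.
have fR : f @: R = f @: Q.
  apply/setP=> r; apply/imsetP/imsetP => [] [q qR ->]; first by exists q.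
  by have [t tR <-] := h q; exists t.
rewrite eqn_leq leq_imset_card fR /=.
by move: cR; rewrite card_holes leq_subLR -(cardsC R) leq_add2r.
Qed.

Definition has_shape := exists (D : nat * shape) (x : nat -> Q),
  [/\ D \in shapes, injective_below D.1 x & fits c D.1 x D.2].

Lemma fits_seq (s : seq Q) (D : shape) : uniq s -> (size s, D) \in shapes ->
  Z =i [seq nth q0 s i | i <- holes D] ->
  (forall p q, f p = f q <-> p = q \/ exists2 P, P \in blocks D &
     p \in map (nth q0 s) P /\ q \in map (nth q0 s) P) ->
  has_shape.
Proof.
move=> us sD ZE K; exists (size s, D), (nth q0 s); split=> //=.
  by move=> i j ik jk /eqP; rewrite nth_uniq // => /eqP.
have wf : all (fun x => [&& all (gtn x.1) (holes x.2),
    all (all (gtn x.1)) (blocks x.2), uniq (holes x.2)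
  & uniq (flatten (blocks x.2))]) shapes by [].
by have /and4P[/= ? ? ? ?] := allP wf _ sD; split.
Qed.

(** If nothing new is missing after reading the letter twice, then the image of a
    hole has a preimage that is not a hole. Choosing one for each hole gives a
    map [g] that sends each state to the element of its class outside [Z], so
    the kernel of the letter is the kernel of [g]. *)
Lemma shape_idem : #|Z| <= 2 -> push c Z = Z -> has_shape.
Proof.
move=> Z2 pZ.
have /fin_all_exists[g gP] q : exists p,
    [/\ p \notin Z, f p = f q & q \notin Z -> p = q].
  have [qZ|qN] := boolP (q \in Z); last by exists q.
  have [p /andP[pN /eqP fp]|no] := pickP (fun p => (p \notin Z) && (f p == f q)).
    by exists p.
  have : f q \in Z.
    rewrite -pZ; apply/in_push=> p fp; apply/negPn/negP=> pN.
    by have := no p; rewrite pN /f fp eqxx.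
  by move/in_push/(_ _ erefl); rewrite inE.
have gN q : g q \notin Z by case: (gP q).
have fg q : f (g q) = f q by case: (gP q).
have g_id q : q \notin Z -> g q = q by case: (gP q).
have injZ : {in ~: Z &, injective f}.
  apply: transversal_inj; first by rewrite setCK.
  by move=> q; exists (g q); rewrite // inE.
have eq_g (u v : Q) : f u = f v <-> g u = g v.
  split=> [|guv]; last by rewrite -fg guv fg.
  by rewrite -(fg u) -(fg v); apply: injZ; rewrite inE.
have K (s : seq Q) (D : shape) : let img P := map (nth q0 s) P in
    (forall P, P \in blocks D -> {in img P &, forall u v : Q, g u = g v}) ->
    (forall t, t \in Z ->
       exists2 P, P \in blocks D & forall u : Q, g u = g t -> u \in img P) ->
    forall u v : Q, f u = f v <-> u = v \/ exists2 P, P \in blocks D &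
      u \in img P /\ v \in img P.
  move=> img const cover u v; split=> [/eq_g guv|[->//|[P PD [uP vP]]]]; last first.
    by apply/eq_g; apply: const uP vP.
  have [/cover[P PD uP]|uN] := boolP (u \in Z).
    by right; exists P => //; split; apply: uP.
  have [/cover[P PD uP]|vN] := boolP (v \in Z).
    by right; exists P => //; split; apply: uP.
  by left; rewrite -(g_id u uN) guv g_id.
have ZE : Z =i enum Z by move=> r; rewrite mem_enum.
have := enum_uniq Z; move: Z2; rewrite cardE.
case: (enum Z) ZE => [|z [|z' [|]]] //= ZE _ uZ.
- by apply: (@fits_seq [::] (Shape [::] [::])) => //; apply: K => // t; rewrite ZE.
- have block t : g t = g z -> t \in [:: z; g z].
    rewrite !inE; have [//|tz <-] := eqVneq t z.
    by rewrite g_id ?eqxx ?orbT // ZE inE.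
  have zp : z != g z by apply: contraNneq (gN z) => <-; rewrite ZE mem_head.
  apply: (@fits_seq [:: z; g z] (Shape [:: [:: 0; 1]] [:: 0])) => //.
    by rewrite /= inE zp.
  apply: K => /= [P|t]; last first.
    by rewrite ZE inE => /eqP->; exists [:: 0; 1]; rewrite ?mem_head.
  rewrite inE => /eqP-> u v /=.
  by rewrite !inE => /orP[]/eqP-> /orP[]/eqP->; rewrite ?(g_id (g _)).
- have block (t p : Q) : g t = p -> [|| t == z, t == z' | t == p].
    have [|/g_id -> ->] := boolP (t \in Z); rewrite ?eqxx ?orbT //.
    by rewrite ZE !inE orbA => ->.
  have ggE (q : Q) : g (g q) = g q by rewrite g_id.
  have gNz q : (g q == z = false) * (g q == z' = false).
    by have := gN q; rewrite ZE !inE negb_or => /andP[/negbTE-> /negbTE->].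
  have zgN q : (z == g q = false) * (z' == g q = false) by rewrite !(eq_sym _ (g q)) !gNz.
  move: uZ; rewrite inE andbT => /negbTE zz'.
  have [gzz'|/negbTE gzz'] := eqVneq (g z) (g z').
    apply: (@fits_seq [:: z; z'; g z] (Shape [:: [:: 0; 1; 2]] [:: 0; 1])) => //.
      by rewrite /= !inE zz' !zgN.
    apply: K => /= [P|t]; last first.
      rewrite ZE => tz; exists [:: 0; 1; 2]; rewrite ?mem_head // => u.
      have -> : g t = g z by move: tz; rewrite !inE => /orP[]/eqP->.
      by rewrite /= !inE => /block.
    rewrite inE => /eqP-> u v /=.
    by rewrite !inE => /or3P[]/eqP-> /or3P[]/eqP->; rewrite ?ggE ?gzz'.
  apply: (@fits_seq [:: z; z'; g z; g z']
            (Shape [:: [:: 0; 2]; [:: 1; 3]] [:: 0; 1])) => //.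
    by rewrite /= !inE zz' gzz' !zgN.
  apply: K => /= [P|t]; last first.
    rewrite ZE !inE => /orP[]/eqP->.
      exists [:: 0; 2]; rewrite ?mem_head // => u gu; rewrite /= !inE.
      case/or3P: (block _ _ gu) => [->|/eqP uz'|->]; rewrite ?orbT //.
      by rewrite -gu uz' eqxx in gzz'.
    exists [:: 1; 3]; rewrite ?inE ?eqxx ?orbT // => u gu; rewrite /= !inE.
    case/or3P: (block _ _ gu) => [/eqP uz|->|->]; rewrite ?orbT //.
    by rewrite -gu uz eqxx in gzz'.
  rewrite !inE => /orP[]/eqP-> u v /=;
  by rewrite !inE => /orP[]/eqP-> /orP[]/eqP->; rewrite ?ggE.
Qed.

(** When reading the letter twice does miss a further state, there is a single
    hole [z], and the new missing state is its image; so [z] is alone in its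
    class, and the one class with two elements avoids [z]. *)
Lemma shape_of_letter : #|Z| <= 2 -> #|push c Z| <= 2 -> has_shape.
Proof.
move=> Z2 pZ2; have sZ : Z \subset push c Z by apply: pushS; apply: sub0set.
have [le|lt] := leqP #|push c Z| #|Z|.
  by apply: shape_idem => //; apply/esym/eqP; rewrite eqEcard sZ.
have cZ : #|Z| = 1.
  have := leq_trans lt pZ2; rewrite ltnS; case E: #|Z| => [|[]] // _.
  by move: lt; rewrite (cards0_eq E) -/Z E.
have /cards1P[z ZE] := introT eqP cZ.
have : ~~ (push c Z \subset Z).
  by apply: contraL lt => /subset_leq_card; rewrite -leqNgt.
case/subsetPn=> r /in_push rP rN.
(* [r] is the image of [z], and all its preimages are holes *)
have fr (q : Q) : f q = f z -> q = z.
  have : [exists p, f p == r].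
    apply: contraR rN => /existsPn no; apply/in_push=> p fp.
    by have := no p; rewrite /f fp eqxx.
  case/existsP=> p /eqP fp; have := rP p fp; rewrite ZE inE => /eqP pz.
  by rewrite -pz fp => /rP; rewrite ZE inE pz => /eqP.
have [x [y [xy fxy]]] : exists x y, x != y /\ f x = f y.
  have : ~~ injectiveb f.
    by apply/injectiveP=> f_inj; move: cZ; rewrite card_holes card_imset // subnn.
  by case/injectivePn=> x [y xy fxy]; exists x, y.
have xz : x != z by apply: contraNneq xy => xz; rewrite xz in fxy *; rewrite (fr y).
have yz : y != z by apply: contraNneq xy => yz; rewrite yz in fxy *; rewrite (fr x).
have inj_x : {in ~: [set x] &, injective f}.
  apply: transversal_inj; first by rewrite setCK cards1 cZ.
  move=> q; have [->|qx] := eqVneq q x; last by exists q; rewrite // !inE.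
  by exists y; rewrite // !inE eq_sym.
apply: (@fits_seq [:: z; x; y] (Shape [:: [:: 1; 2]] [:: 0])) => //=.
- by rewrite !inE negb_or xy eq_sym xz eq_sym yz.
- by move=> q; rewrite ZE !inE.
have fx (p q : Q) : f p = f q -> p != q -> p = x -> q = y.
  move=> fpq pq px; apply: inj_x; rewrite ?inE -?fxy -?px //; first by rewrite eq_sym.
  by rewrite px eq_sym.
move=> p q; split=> [fpq|[->|[P]]] //; last first.
  by rewrite inE => /eqP-> /= []; rewrite !inE => /orP[]/eqP-> /orP[]/eqP->.
have [->|pq] := eqVneq p q; [by left | right].
exists [:: 1; 2]; rewrite ?mem_head //= !inE.
have [px|px] := eqVneq p x; first by rewrite (fx p q) // eqxx orbT.
have [qx|qx] := eqVneq q x; first by rewrite (fx q p) ?eqxx ?orbT // eq_sym.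
by case/eqP: pq; apply: inj_x; rewrite ?inE.
Qed.
End LetterShape.

Lemma fits_shape (q0 : Q) c :
  deficiency A [:: c] <= 2 -> deficiency A [:: c; c] <= 2 -> has_shape c.
Proof.
rewrite !deficiency_missing -[[:: c; c]]/(rcons [:: c] c) missing_rcons missing1.
exact: (shape_of_letter q0).
Qed.

(** * The theorem *)

Lemma checkP (q0 : Q) fuel words : check fuel words ->
  (forall c, deficiency A [:: c] <= 2 /\ deficiency A [:: c; c] <= 2) ->
  {in words, forall w, deficiency A w <= 2} ->
  forall w, deficiency A w <= 2.
Proof.
move=> chk dc dw.
have [Da [x [Dain ix fa]]] := fits_shape q0 (dc a).1 (dc a).2.
have [Db [y [Dbin iy fb]]] := fits_shape q0 (dc b).1 (dc b).2.
have [[n s] [e [xin nn ee ie [ss sn sy]]]] := namingsP ix iy.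
rewrite /= in xin nn ie ss sn sy.
move/allP/(_ _ Dain)/allP/(_ _ Dbin)/allP/(_ _ xin): chk.
apply: (@searchP _ _ n e _ _ [::]).
- split=> //; case; split=> //=.
    exact: fits_agree fa.
  exact: (fits_rename iy ss sn sy fb).
- by split=> // r; rewrite missing_nil inE.
- by rewrite deficiency_missing missing_nil cards0.
- exact: dw.
Qed.
End Automaton.

(** The choice and the order of the factors come from a numerical optimisation of
    the size of the search; [w3] itself settles what the others leave open. *)
Definition factors : seq (seq letter) :=
  [:: [:: b; b; b; a; b; b];
      [:: a; b; a; b; a];
      [:: a; b; b; a; b; b; a; b; a; b; b; a; b; a];
      [:: a; a; a; b; a; b];
      [:: b; a; a; b; a; a; b];
      [:: b; a; a; b; a; b; a; a; b; a; a; b];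
      [:: b; a; a; b; b; a; a; b; b; a];
      [:: a; b; b; b; a; b; b; b; a];
      w3].

Lemma factors_infix : all (fun w => infix w w3)
  ([:: [:: a]; [:: a; a]; [:: b]; [:: b; b]] ++ factors).
Proof. by vm_compute. Qed.

(** The fuel only has to exceed the depth of the search. *)
Lemma check_factors : check 1000 factors.
Proof. by vm_compute. Qed.

Theorem mainTheorem2 : size w3 = 53 /\ collapsing 3 w3.
Proof.
split=> //; split=> // A [v [_ v3]]; split=> //.
rewrite leqNgt ltnS; apply/negP=> w3_small.
have small : {in [:: [:: a]; [:: a; a]; [:: b]; [:: b; b]] ++ factors,
    forall w, deficiency A w <= 2}.
  move=> w /(allP factors_infix) /infixP[s [t E]].
  by apply: leq_trans w3_small; rewrite E; apply: deficiency_factor.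
have [q0 _|noq] := pickP (state A); last first.
  by move: v3; rewrite /deficiency (eq_card0 noq).
suff le2 : forall w, deficiency A w <= 2 by move: v3; rewrite leqNgt ltnS le2.
apply: (checkP q0 check_factors) => [c|w wf]; last first.
  by apply: small; rewrite mem_cat wf orbT.
by case: c; split; apply: small; rewrite mem_cat !inE eqxx ?orbT.
Qed.
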